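(* Let $p<q<r$ be primes and let $G$ be a finite group such that $|G/Z(G)|=pqr$. Then $|\operatorname{Cent}(G)|=r+2$ or $|\operatorname{Cent}(G)|=qr+2$.
   Context: For a group $G$, $Z(G)$ is its center, $C(x)$ is the centralizer of $x$ in $G$, and $\operatorname{Cent}(G)=\{C(x)\mid x\in G\}$ is the set of distinct element centralizers of $G$ (it includes $G=C(1)$ itself). *)

(* Defs.v *)
From mathcomp Require Import all_boot all_fingroup all_solvable.

Set Implicit Arguments.
Unset Strict Implicit.
Unset Printing Implicit Defensive.

Local Open Scope group_scope.

(* A set of sets, so coinciding centralizers are counted once in #|Cent G|. *)
Definition Cent (gT : finGroupType) (G : {group gT}) : {set {set gT}} :=
  [set 'C_G[x] | x in G].

(* Main.v *)
(** The group Q = G / Z(G) has squarefree order. Two elements of G whose images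
    in Q commute lie in a central extension of an abelian, hence cyclic,
    subgroup of Q, so they commute. It follows that centralizers in G are the
    preimages of centralizers in Q and that Z(Q) = 1. A centerless group of
    order pqr is a Frobenius group with abelian complements and with kernel
    either its Sylow r-subgroup R or C(R), which is then abelian of order qr.
    In a Frobenius group with abelian kernel K and abelian complement H, the
    centralizers are the whole group, K and the |K| conjugates of H. *)
Require Import Defs.
From mathcomp Require Import all_boot all_fingroup all_solvable.
From mathcomp Require Import zify.

Set Implicit Arguments.
Unset Strict Implicit.
Unset Printing Implicit Defensive.

(** A group of order [p] has [p.-1] automorphisms, so this rules out nontrivial actions of groups of
    order [s] on it. *)
Lemma coprime_prime_pred p s :
  prime p -> prime s -> p <= s -> coprime s p.-1.
Proof.
move=> /prime_gt1 p1 s_pr le_ps.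
by rewrite prime_coprime // gtnNdvd //; lia.
Qed.

Lemma dvdn_mul_primes p q d : prime p -> prime q -> d %| p * q ->
  [\/ d = 1, d = p, d = q | d = (p * q)]%N.
Proof.
move=> p_pr q_pr; have [/dvdnP[e ->]|npd] := boolP (p %| d).
  rewrite mulnC dvdn_pmul2l ?prime_gt0 // => e_q.
  case/primeP: q_pr => _ /(_ e e_q) /orP[]/eqP->; last by constructor 4.
  by constructor 2; rewrite muln1.
rewrite Gauss_dvdr 1?coprime_sym ?prime_coprime // => d_q.
by case/primeP: q_pr => _ /(_ d d_q) /orP[]/eqP->; [constructor 1|constructor 3].
Qed.

Local Open Scope group_scope.

(** * Centralizers modulo the center *)

Section CentralQuotient.

Variables (gT : finGroupType) (G : {group gT}).
Hypothesis ZgroupGZ : Zgroup (G / 'Z(G)).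

Let nZ : {subset G <= 'N('Z(G))}.
Proof. exact/subsetP/normal_norm/center_normal. Qed.

Lemma commute_coset_center : {in G &, forall x y,
  commute (coset 'Z(G) x) (coset 'Z(G) y) -> commute x y}.
Proof.
move=> x y Gx Gy cxy; pose H := <[coset 'Z(G) x]> <*> <[coset 'Z(G) y]>.
have sHG : H \subset G / 'Z(G) by rewrite join_subG !cycle_subG !mem_quotient.
have abH : abelian H.
  by rewrite abelianY !cycle_abelian cycle_subG /= cent_cycle; apply/cent1P.
(* A nilpotent group with cyclic Sylow subgroups is cyclic. *)
have cycH : cyclic H.
  exact: nil_Zgroup_cyclic (ZgroupS sHG ZgroupGZ) (abelian_nil abH).
have sLG : coset 'Z(G) @*^-1 H \subset G.
  by have := morphpreS (coset 'Z(G)) sHG; rewrite quotientGK ?center_normal.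
have abL : abelian (coset 'Z(G) @*^-1 H).
  apply: (@cyclic_factor_abelian _ 'Z(G)); last by rewrite /= cosetpreK.
  rewrite subsetI sub_cosetpre (subset_trans (subsetIr _ _)) //.
  exact: centS.
have [HX HY] : coset 'Z(G) x \in H /\ coset 'Z(G) y \in H.
  split; apply: subsetP (cycle_id _); [exact: joing_subl | exact: joing_subr].
by apply: (centsP abL); rewrite mem_morphpre ?nZ.
Qed.

Lemma cent1_coset_center : {in G, forall x,
  'C_G[x] = coset 'Z(G) @*^-1 'C_(G / 'Z(G))[coset 'Z(G) x]}.
Proof.
move=> x Gx; rewrite morphpreI quotientGK ?center_normal //.
apply/setP=> y; rewrite [LHS]in_setI [RHS]in_setI; apply: andb_id2l => Gy.
rewrite morphpreE in_setI nZ //= [RHS]in_set.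
apply/idP/idP=> /cent1P cxy; apply/cent1P; last first.
  exact: commute_coset_center.
by rewrite /commute -!morphM ?nZ // cxy.
Qed.

Lemma center_quotient_center : 'Z(G / 'Z(G)) = 1.
Proof.
apply/trivgP/subsetP=> _ /setIP[/morphimP[x Nx Gx ->] cGx].
rewrite inE; apply/eqP/coset_id; rewrite inE Gx /=.
apply/centP=> y Gy; apply: commute_coset_center => //.
exact: (centP cGx) (mem_quotient _ Gy).
Qed.

(** Taking full preimages is injective on subsets of the quotient, and [cent1_coset_center] makes it
    a bijection between the two families of centralizers. *)
Lemma card_Cent_quotient_center : #|Cent (G / 'Z(G))| = #|Cent G|.
Proof.
have injpre : injective (fun A : {set coset_of 'Z(G)} => coset 'Z(G) @*^-1 A).
  by move=> A B eqAB; rewrite -[A]cosetpreK eqAB cosetpreK.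
rewrite -(card_imset _ injpre); congr #|pred_of_set _|.
apply/setP=> A; apply/imsetP/imsetP=> [[_ /imsetP[_ /morphimP[x _ Gx ->] ->] ->]|].
  by exists x; rewrite ?cent1_coset_center.
case=> x Gx ->; exists 'C_(G / 'Z(G))[coset 'Z(G) x].
  by apply: imset_f; apply: mem_quotient.
exact: cent1_coset_center.
Qed.

End CentralQuotient.

(** * Centralizers in a Frobenius group *)

Section FrobeniusCent.

Variables (gT : finGroupType) (G K H : {group gT}).
Hypothesis frobG : [Frobenius G = K ><| H].
Hypotheses (abK : abelian K) (abH : abelian H).

(** A Frobenius complement is self-normalizing, so its normalizer in [K] lies in the trivial group
    [K :&: H]. *)
Lemma card_Frobenius_compl_conj : #|H :^: K| = #|K|.
Proof.
have [defG _ _ _ _] := Frobenius_context frobG.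
have [_ _ /and3P[_ _ /eqP defN]] := and3P frobG.
have [_ sKHG _ tiKH] := sdprodP defG; have [sKG sHG] := mulG_sub sKHG.
rewrite card_conjugates.
suffices -> : 'N_K(H) = 1 by rewrite indexg1.
apply/trivgP; rewrite -tiKH subsetI subsetIl /=.
by rewrite -{2}defN setISS // normD1.
Qed.

Lemma cent1_Frobenius_ker : {in K^#, forall x, 'C_G[x] = K}.
Proof.
move=> x K1x; apply/eqP; rewrite eqEsubset (Frobenius_cent1_ker frobG) //=.
have [_ _ _ /proper_sub sKG _] := Frobenius_context frobG.
rewrite subsetI sKG sub_cent1; apply: subsetP abK _ _.
by case/setD1P: K1x.
Qed.

Lemma cent1_Frobenius_compl : {in H^#, forall x, 'C_G[x] = H}.
Proof.
move=> x H1x; have [ntx Hx] := setD1P H1x.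
have [defG _ _ /proper_sub sKG /proper_sub sHG] := Frobenius_context frobG.
have [_ sKHG _ tiKH] := sdprodP defG.
have sHC : H \subset 'C_G[x].
  by rewrite subsetI sHG sub_cent1; apply: subsetP abH _ _.
have sCG : 'C_G[x] \subset K * H by rewrite sKHG subsetIl.
(* By the modular law the centralizer is ['C_K[x] * H], and [x] has no nontrivial fixed point in
   [K]. *)
rewrite -(setIidPl sCG) -group_modr //.
have -> : 'C_G[x] :&: K = 'C_K[x].
  by rewrite setIAC (setIidPr sKG).
by rewrite (Frobenius_reg_ker frobG) ?mul1g.
Qed.

(** [K] and the [K]-conjugates of [H^#] partition [G], so up to conjugation a nontrivial element
    falls under one of the two preceding lemmas. *)
Lemma Cent_Frobenius : Cent G = gval G |: (gval K |: (H :^: K)).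
Proof.
have [defG ntK ntH /proper_sub sKG /proper_sub sHG] := Frobenius_context frobG.
apply/setP=> A; apply/imsetP/idP=> [[x Gx ->]|].
  have [-> | ntx] := eqVneq x 1; first by rewrite cent11T setIT setU11.
  apply/setU1P; right.
  have [/eqP cov _ _] := and3P (Frobenius_partition frobG).
  move: Gx; rewrite -{1}cov => /bigcupP[_ /setU1P[-> Kx | /imsetP[k Kk ->]]].
    by rewrite cent1_Frobenius_ker ?setU11 // !inE ntx.
  rewrite mem_conjg => Hxk; apply/setU1P; right; apply/imsetP; exists k => //.
  rewrite -(cent1_Frobenius_compl Hxk) conjIg conjGid ?(subsetP sKG) //.
  by rewrite -cent1J conjgKV.
case/setU1P=> [->|/setU1P[->|/imsetP[k Kk ->]]].
- by exists 1; rewrite ?group1 // cent11T setIT.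
- have [x Kx ntx] := trivgPn _ ntK; exists x; first exact: subsetP Kx.
  by rewrite cent1_Frobenius_ker // !inE ntx.
have [x Hx ntx] := trivgPn _ ntH; have Gk := subsetP sKG _ Kk.
exists (x ^ k); first by rewrite groupJ // (subsetP sHG).
have -> : 'C_G[x ^ k] = 'C_G[x] :^ k by rewrite cent1J conjIg conjGid.
by rewrite cent1_Frobenius_compl // !inE ntx.
Qed.

Lemma card_Cent_Frobenius : #|Cent G| = #|K| + 2.
Proof.
have [defG ntK ntH pKG pHG] := Frobenius_context frobG.
have [_ _ _ tiKH] := sdprodP defG.
rewrite Cent_Frobenius !cardsU1 card_Frobenius_compl_conj.
(* If [K] were [H :^ k] with [k] in [K], conjugating back would give [K = H], against
   [K :&: H = 1]. *)
have -> : gval K \notin H :^: K.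
  apply/imsetP=> -[k Kk defK]; case/eqP: ntK.
  by rewrite -tiKH -(conjsgK k H) -defK conjGid ?groupV // setIid.
have -> : gval G \notin gval K |: (H :^: K); last lia.
apply/setU1P=> -[eqGK | /imsetP[k Kk eqGH]].
  by rewrite eqGK properxx in pKG.
by have := proper_card pHG; rewrite eqGH cardJg ltnn.
Qed.

End FrobeniusCent.

(** * Actions on cyclic groups, elements of prime order, and a Frobenius criterion *)

(** [A] acts on [R] through the abelian group [Aut R], so commutators act trivially. *)
Lemma der1_sub_cent_cyclic (gT : finGroupType) (A R : {group gT}) :
  cyclic R -> A \subset 'N(R) -> A^`(1) \subset 'C(R).
Proof.
move=> cycR nRA; have nRA' := subset_trans (der_sub 1 A) nRA.
rewrite -ker_conj_aut ker_trivg_morphim nRA' /= derg1 morphimR //.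
apply/trivgP/commG1P; apply: abelianS (Aut_cyclic_abelian cycR).
exact: Aut_conj_aut.
Qed.

Section PrimeOrder.

Variables (gT : finGroupType) (s : nat).
Hypothesis s_pr : prime s.

(** The image of [A] in [Aut T] has order dividing both [#|A|] and [s.-1]. *)
Lemma norm_prime_sub_cent (A T : {group gT}) :
  #|T| = s -> A \subset 'N(T) -> coprime #|A| s.-1 -> A \subset 'C(T).
Proof.
move=> oT nTA coA; have cycT : cyclic T by rewrite prime_cyclic ?oT.
rewrite -ker_conj_aut ker_trivg_morphim nTA /= subG1 trivg_card1.
rewrite -dvdn1 -(eqP coA) dvdn_gcd dvdn_morphim /=.
rewrite -(totient_prime s_pr) -oT -card_Aut_cyclic //.
exact/cardSg/Aut_conj_aut.
Qed.

(** Here the Sylow [s]-subgroups are exactly the subgroups of order [s]; each element of order [s]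
    generates one of them, and each has [s.-1] generators. *)
Lemma card_elts_prime_order (G P : {group gT}) :
  s.-Sylow(G) P -> #|P| = s ->
  #|[set x in G | #[x] == s]| = (#|'Syl_s(G)| * s.-1)%N.
Proof.
move=> sylP oP.
have SylE (R : {group gT}) : (R \in 'Syl_s(G)) = (R \subset G) && (#|R| == s).
  by rewrite inE pHallE -(card_Hall sylP) oP.
rewrite -sum1_card (partition_big (fun x => <[x]>%G) (mem 'Syl_s(G))) /=; last first.
  by move=> x /[1!inE] /andP[Gx ox]; rewrite SylE cycle_subG Gx.
rewrite -sum_nat_const; apply: eq_bigr => R; rewrite SylE => /andP[sRG /eqP oR].
have /cyclicP[y defR] : cyclic R by rewrite prime_cyclic ?oR.
rewrite -(totient_prime s_pr) -oR defR -[#|_|]/#[y] totient_gen -sum1_card.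
apply: eq_bigl => x; rewrite !inE /generator -defR.
apply/andP/eqP=> [[_ /eqP/(congr1 val) /= ->] // | Rx].
have eqR : <[x]>%G = R by apply/val_inj/esym.
rewrite eqR /order -defR -Rx !eqxx (subsetP sRG) //.
by rewrite [in x \in _]Rx cycle_id.
Qed.

End PrimeOrder.

(** Schur-Zassenhaus provides a complement [H]. An element of [H] fixing a nontrivial element of [K]
    lies in [K] by the centralizer condition, hence is trivial; so [G] is Frobenius. *)
Lemma card_Cent_Hall_kernel (gT : finGroupType) (G K : {group gT}) :
    K <| G -> Hall G K -> abelian K -> K :!=: 1 -> K :!=: G ->
    {in K^#, forall x, 'C_G[x] \subset K} ->
    (forall H : {group gT}, K ><| H = G -> abelian H) ->
  #|Cent G| = #|K| + 2.
Proof.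
move=> nsKG hallK abK ntK neqKG cKG abH.
have /splitsP[H /complP[tiKH defKH]] := SchurZassenhaus_split hallK nsKG.
have sHG : H \subset G by rewrite -defKH mulG_subr.
have defG : K ><| H = G.
  by rewrite sdprodE // (subset_trans sHG (normal_norm nsKG)).
apply: (card_Cent_Frobenius (H := H)) => //; last exact: abH.
apply/Frobenius_semiregularP => // [|x /setD1P[ntx Hx]].
  by apply: contraNneq neqKG => H1; rewrite -defG H1 sdprodg1.
apply/trivgP/subsetP=> y /setIP[Ky cxy]; apply: contraR ntx => nty.
suffices: x \in K :&: H by rewrite tiKH inE.
rewrite inE Hx andbT; apply: subsetP (cKG y _) _ _.
  by rewrite inE in nty; rewrite !inE nty.
by rewrite inE (subsetP sHG) // cent1C.
Qed.

(** * Groups of order [p * q * r] *)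

Section CenterlessOrderPQR.

Variables (gT : finGroupType) (G : {group gT}) (p q r : nat).
Hypotheses (p_pr : prime p) (q_pr : prime q) (r_pr : prime r).
Hypotheses (lt_pq : p < q) (lt_qr : q < r).
Hypothesis oG : #|G| = (p * q * r)%N.

Lemma logn_pqr s : s \in [:: p; q; r] -> logn s #|G| = 1%N.
Proof.
have [p0 q0 r0] := And3 (prime_gt0 p_pr) (prime_gt0 q_pr) (prime_gt0 r_pr).
rewrite oG !lognM ?muln_gt0 ?p0 ?q0 // !inE.
by case/or3P=> /eqP->; rewrite !logn_prime // ?eqxx; lia.
Qed.

Lemma card_Sylow_pqr (s : nat) (P : {group gT}) :
  s \in [:: p; q; r] -> s.-Sylow(G) P -> #|P| = s.
Proof. by move=> ss /card_Hall->; rewrite p_part logn_pqr. Qed.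

Lemma Zgroup_pqr : Zgroup G.
Proof.
apply/forall_inP=> V /SylowP[s s_pr sylV].
have [ss|ns] := boolP (s \in [:: p; q; r]).
  by rewrite prime_cyclic // (card_Sylow_pqr ss sylV).
suffices V1 : #|V| = 1%N by rewrite (card1_trivg V1) cyclic1.
rewrite (card_Hall sylV) p_part oG !lognM ?muln_gt0 ?prime_gt0 // !logn_prime //.
by move: ns; rewrite !inE !negb_or => /and3P[/negPf-> /negPf-> /negPf->].
Qed.

(* Otherwise there are p q Sylow r-subgroups, and the p q elements outside
   their nontrivial parts leave room for a single Sylow q-subgroup, which is
   then centralized by the Sylow r-subgroups since r does not divide q - 1. *)
Lemma Sylow_max_prime_normal (R : {group gT}) : r.-Sylow(G) R -> R <| G.
Proof.
move=> sylR; have [T sylT] := Sylow_exists q G.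
have [p1 q1 r1] := And3 (prime_gt1 p_pr) (prime_gt1 q_pr) (prime_gt1 r_pr).
have oR : #|R| = r by apply: card_Sylow_pqr sylR; rewrite !inE eqxx !orbT.
have oT : #|T| = q by apply: card_Sylow_pqr sylT; rewrite !inE eqxx !orbT.
have [sRG sTG] := (pHall_sub sylR, pHall_sub sylT).
apply/idPn=> nnR.
(* The Sylow count divides the group order and is 1 modulo [s], so it divides the cofactor [m]. *)
have nSyl_dvd s m : prime s -> (m * s = p * q * r)%N ->
    #|'Syl_s(G)| %| m.
  move=> s_pr def_m; rewrite -(dvdn_pmul2r (prime_gt0 s_pr)) def_m -oG.
  rewrite Gauss_dvd ?card_Syl_dvd; last first.
    by rewrite -coprime_modl card_Syl_mod // coprime1n.
  by rewrite oG -def_m dvdn_mull.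
have nr : #|'Syl_r(G)| = (p * q)%N.
  have modr := card_Syl_mod G r_pr.
  have [Er|Er|Er|//] := dvdn_mul_primes p_pr q_pr (nSyl_dvd r _ r_pr erefl).
  - case/negP: nnR; rewrite /normal sRG.
    have /eqP := card_Syl sylR; rewrite Er eq_sym indexg_eq1 subsetI => /andP[_].
    by [].
  - by rewrite Er modn_small in modr; lia.
  - by rewrite Er modn_small in modr; lia.
have nq : #|'Syl_q(G)| = 1%N.
  have modq := card_Syl_mod G q_pr.
  have le_sum : #|'Syl_r(G)| * r.-1 + #|'Syl_q(G)| * q.-1 < p * q * r.
    rewrite -(card_elts_prime_order r_pr sylR oR) -(card_elts_prime_order q_pr sylT oT).
    rewrite -oG (cardsD1 1 G) group1 add1n ltnS -cardsUI.
    rewrite (_ : _ :&: _ = set0) ?cards0 ?addn0.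
      apply/subset_leq_card/subsetP=> x; rewrite !inE => ox.
      have -> : x \in G by case/orP: ox => /andP[].
      rewrite andbT; apply: contraTneq ox => ->; rewrite order1; lia.
    apply/setP=> x; rewrite !inE.
    case: (x \in G) => //=; apply/andP=> -[/eqP-> /eqP]; lia.
  rewrite nr in le_sum.
  (* The value [p] is not 1 modulo [q]. For [r] or [p * r], [le_sum] would give [r * q.-1 < p * q],
     impossible as [p < q < r]. *)
  have [//|Eq|Eq|Eq] := dvdn_mul_primes p_pr r_pr (nSyl_dvd q _ q_pr (mulnAC _ _ _)).
  - by rewrite Eq modn_small in modq; lia.
  - by rewrite Eq in le_sum; nia.
  - by rewrite Eq in le_sum; nia.
have nTG : G \subset 'N(T).
  have /eqP := card_Syl sylT; rewrite nq eq_sym indexg_eq1 subsetI => /andP[_].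
  by [].
have cTR : R \subset 'C(T).
  apply: (norm_prime_sub_cent q_pr oT (subset_trans sRG nTG)).
  by rewrite oR coprime_prime_pred // ltnW.
(* Having [p * q] conjugates, [R] has a normalizer of order [r], which cannot contain [T] of order
   [q]. *)
have : #|T| %| #|'N_G(R)|.
  by rewrite cardSg // subsetI sTG cents_norm // centsC.
have := Lagrange (subsetIl G 'N(R)); rewrite -(card_Syl sylR) nr oG oT mulnC.
move/eqP; rewrite eqn_pmul2l ?muln_gt0 ?prime_gt0 // => /eqP->.
by rewrite dvdn_prime2 // => /eqP; lia.
Qed.

Hypothesis Z1 : 'Z(G) = 1.

Lemma normal_central_eq1 (P : {group gT}) : P <| G -> G \subset 'C(P) -> P :=: 1.
Proof.
move=> /normal_sub sPG cPG; apply/trivgP.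
by rewrite -Z1 subsetI sPG centsC.
Qed.

(** The cases are the values of the index [m] of [R] in [C], a divisor of [p * q]. The Frobenius
    kernel is [R] for [m = 1] and [C] for [m = q]; the values [p] and [p * q] would give a
    nontrivial center. *)
Lemma card_Cent_centerless_pqr :
  #|Cent G| = r + 2 \/ #|Cent G| = (q * r + 2)%N.
Proof.
have [p1 q1 r1] := And3 (prime_gt1 p_pr) (prime_gt1 q_pr) (prime_gt1 r_pr).
have lt_r_qr : r < q * r by rewrite ltn_Pmull // prime_gt0.
have lt_qr_pqr : q * r < p * q * r.
  by rewrite -mulnA ltn_Pmull // muln_gt0 !prime_gt0.
have [R sylR] := Sylow_exists r G.
have oR : #|R| = r by apply: card_Sylow_pqr sylR; rewrite !inE eqxx !orbT.
have nsRG := Sylow_max_prime_normal sylR; have sRG := normal_sub nsRG.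
have ntR : R :!=: 1 by rewrite trivg_card1 oR; lia.
have abR : abelian R by rewrite cyclic_abelian ?prime_cyclic ?oR.
have nRG := normal_norm nsRG.
pose C := 'C_G(R)%G; have nsCG : C <| G.
  by have := subcent_normal G R; rewrite (setIidPl nRG).
have sRC : R \subset C by rewrite subsetI sRG.
have sRZC : R \subset 'Z(C) by rewrite subsetI sRC centsC subsetIr.
have [m oC] := dvdnP (cardSg sRC); rewrite oR in oC.
have m_dvd : m %| p * q.
  by rewrite -(dvdn_pmul2r (prime_gt0 r_pr)) -oC -oG cardSg // subsetIl.
(* [R] is central in [C] with quotient of prime order [m], hence cyclic. *)
have abC : prime m -> abelian C.
  move=> m_pr; apply: cyclic_factor_abelian sRZC _; apply: prime_cyclic.
  rewrite card_quotient ?(subset_trans (subsetIl _ _) nRG) //.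
  by rewrite -divgS // oC oR mulnK ?prime_gt0.
have [m1|mp|mq|mpq] := dvdn_mul_primes p_pr q_pr m_dvd.
- left; rewrite -oR.
  have sCR : 'C_G(R) \subset R.
    have /eqP <- : R :==: C by rewrite eqEcard sRC oR oC m1 mul1n leqnn.
    exact: subxx.
  apply: card_Cent_Hall_kernel => //.
  + exact: pHall_Hall sylR.
  + by apply: contraTneq lt_r_qr => eqRG; rewrite -leqNgt -{2}oR eqRG oG ltnW.
  (* A nontrivial [x] generates [R], which has prime order, so centralizing [x] means centralizing
     [R]. *)
  + move=> x /setD1P[ntx Rx]; apply: subset_trans sCR; rewrite setIS //.
    rewrite -cent_cycle centS // prime_meetG ?oR //.
    apply: contraNneq ntx => tiRx; rewrite -cycle_eq1 -subG1 -tiRx.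
    by rewrite subsetI cycle_subG Rx subxx.
  (* The derived subgroup of [H] centralizes the cyclic group [R], so it lies in [R], which meets
     [H] trivially. *)
  move=> H /sdprodP[_ defG nRH tiRH]; apply/derG1P/trivgP.
  rewrite -tiRH subsetI der_sub andbT; apply: subset_trans sCR; rewrite subsetI.
  rewrite der1_sub_cent_cyclic ?prime_cyclic ?oR // andbT.
  by rewrite (subset_trans (der_sub 1 H)) // -defG mulG_subr.
- have abCp : abelian C by apply: abC; rewrite mp.
  have sylP : p.-Sylow(C) 'O_p(C) by rewrite nilpotent_pcore_Hall ?abelian_nil.
  have oP : #|'O_p(C)| = p.
    rewrite (card_Hall sylP) p_part oC mp lognM ?prime_gt0 // !logn_prime //.
    by rewrite eqxx ltn_eqF // (ltn_trans lt_pq).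
  have nsPG : 'O_p(C) <| G by apply: char_normal_trans (pcore_char _ _) nsCG.
  (* No prime divisor of [#|G|] is below [p], so [G] acts trivially on this normal subgroup of order
     [p]. *)
  suffices cPG : G \subset 'C('O_p(C)).
    by have /eqP := normal_central_eq1 nsPG cPG; rewrite trivg_card1 oP gtn_eqF.
  apply: (norm_prime_sub_cent p_pr oP (normal_norm nsPG)).
  by rewrite oG !coprimeMl !coprime_prime_pred // ltnW // (ltn_trans lt_pq).
- right; rewrite mq in oC; rewrite -oC.
  have abCq : abelian C by apply: abC; rewrite mq.
  have iC : #|G : C| = p.
    by rewrite -divgS ?normal_sub // oG oC -mulnA mulnK ?muln_gt0 ?prime_gt0.
  apply: card_Cent_Hall_kernel => //.
  + rewrite /Hall subsetIl iC oC coprimeMl !(coprime_sym _ p) !prime_coprime //.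
    by rewrite !dvdn_prime2 // !ltn_eqF // (ltn_trans lt_pq).
  + by rewrite trivg_card1 oC gtn_eqF // (ltn_trans r1).
  + by apply: contraTneq lt_qr_pqr => eqCG; rewrite -oG -oC eqCG ltnn.
  (* [C] has prime index, so the centralizer of [x], which contains the abelian group [C], is [C]
     unless [x] is central. *)
  + have /maxgroupP[_ maxC] : maximal C G.
      by rewrite p_index_maximal ?normal_sub ?iC.
    move=> x /setD1P[ntx Cx]; have Gx := subsetP (normal_sub nsCG) x Cx.
    have sCCx : C \subset 'C_G[x]%G.
      rewrite subsetI (normal_sub nsCG) sub_cent1; exact: subsetP abCq x Cx.
    suffices pCx : 'C_G[x]%G \proper G by rewrite -(maxC _ pCx sCCx).
    rewrite properEneq subsetIl andbT; apply: contraNneq ntx => defG.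
    suffices: x \in 'Z(G) by rewrite Z1 inE.
    by rewrite inE Gx -sub_cent1 -{1}defG subsetIr.
  move=> H /sdprod_card; rewrite oC oG => oH.
  apply/cyclic_abelian/prime_cyclic; have qr0 : 0 < q * r by rewrite muln_gt0 !prime_gt0.
  suffices -> : #|H| = p by [].
  by apply/eqP; rewrite -(eqn_pmul2l qr0) oH -mulnA mulnC.
suffices cRG : G \subset 'C(R).
  by have /eqP := normal_central_eq1 nsRG cRG; rewrite (negPf ntR).
have /eqP <- : C :==: G by rewrite eqEcard subsetIl oC mpq oG leqnn.
exact: subsetIr.
Qed.

End CenterlessOrderPQR.

Local Close Scope group_scope.

Theorem theorem2p6 (p q r : nat) (gT : finGroupType) (G : {group gT})
  (p_prime : prime p) (q_prime : prime q) (r_prime : prime r)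
  (lt_pq : p < q) (lt_qr : q < r)
  (card_GZ : #|(G / 'Z(G))%g| = p * q * r) :
  #|Cent G| = r + 2 \/ #|Cent G| = q * r + 2.
Proof.
have ZgGZ := Zgroup_pqr p_prime q_prime r_prime lt_pq lt_qr card_GZ.
rewrite -card_Cent_quotient_center //.
apply: (card_Cent_centerless_pqr p_prime) card_GZ _ => //.
exact: center_quotient_center.
Qed.
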